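(* (Nondeterministic version) There is a function $f_N:2^{\Sigma^*}\to 2^{\Sigma^*}$ such that (1) there is a nondeterministic local-polynomial oracle Turing machine $\widehat M$ with $L(\widehat M^A)=f_N(A)$ for every oracle $A$, and (2) for every nondeterministic global-polynomial oracle Turing machine $M$ there is a set $A\subseteq\Sigma^*$ with $L(M^A)=^*\overline{f_N(A)}$. (Deterministic version) There is a function $f_D:2^{\Sigma^*}\to 2^{\Sigma^*}$ such that (1) there is a deterministic local-polynomial oracle Turing machine $\widehat M$ with $L(\widehat M^A)=f_D(A)$ for every oracle $A$, and (2) for every deterministic global-polynomial oracle Turing machine $M$ there is a set $A\subseteq\Sigma^*$ with $L(M^A)=^*\overline{f_D(A)}$.
   Context: $\Sigma=\{0,1\}$. The runtime of a nondeterministic (or deterministic) oracle Turing machine on a given input with a given oracle is the length of its longest computation path; $L(M^A)$ is the set of inputs on which $M^A$ has an accepting path. A machine $M$ is global-polynomial if there is a polynomial $p$ such that for every oracle $D$ the runtime of $M^D$ on every input $x$ is at most $p(|x|)$. A machine $M$ is local-polynomial if for every oracle $D$ there is a polynomial $p_D$ (possibly depending on $D$) such that the runtime of $M^D$ on every input $x$ is at most $p_D(|x|)$. $X=^*Y$ means that $(X\setminus Y)\cup(Y\setminus X)$ is finite; $\overline{X}=\Sigma^*\setminus X$. *)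

(* Defs.v *)
From HB Require Import structures.
From mathcomp Require Import all_boot all_algebra.
From mathcomp Require Import classical_sets cardinality.

Set Implicit Arguments.
Unset Strict Implicit.
Unset Printing Implicit Defensive.

Local Open Scope classical_set_scope.

Definition word := seq bool.

Inductive move := Left | Stay | Right.

Definition ord_of_move (d : move) : 'I_3 :=
  match d with Left => inord 0 | Stay => inord 1 | Right => inord 2 end.

Definition move_of_ord (i : 'I_3) : move :=
  match val i with 0 => Left | 1 => Stay | _ => Right end.

Lemma ord_of_moveK : cancel ord_of_move move_of_ord.
Proof. by case; rewrite /move_of_ord /= inordK. Qed.

HB.instance Definition _ := Finite.copy move (can_type ord_of_moveK).

(* Multitape machines over one-way infinite tapes.  A tape symbol is a blank
   (None), a bit (Some (inl b)) or an auxiliary symbol (Some (inr g)).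
   Tape ord0 holds the input initially and tape ord_max is the oracle tape;
   both are read-write, and the +2 keeps them distinct.  Entering the state
   qquery asks the oracle about the word on the oracle tape and leads in one
   step to qyes or qno, with the tapes and heads unchanged. *)
Record oracleTM := OracleTM {
  state : finType;
  aux : finType;
  nwork : nat;
  qstart : state;
  qaccept : state;
  qquery : state;
  qyes : state;
  qno : state;
  delta : state -> {ffun 'I_nwork.+2 -> option (bool + aux)} ->
    {set state * {ffun 'I_nwork.+2 -> option (bool + aux) * move}}
}.

Definition symbol (M : oracleTM) : finType := option (bool + aux M)%type.

Definition deterministic (M : oracleTM) : Prop :=
  forall (q : state M) (s : {ffun 'I_(nwork M).+2 -> symbol M}),
    #|delta q s| <= 1.

(* Cells beyond the stored sequence are blank. *)
Record tape (M : oracleTM) := Tape { head : nat; cells : seq (symbol M) }.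

Definition scan (M : oracleTM) (t : tape M) : symbol M :=
  nth None (cells t) (head t).

(* Moving left from cell 0 leaves the head on cell 0. *)
Definition act (M : oracleTM) (t : tape M) (a : symbol M * move) : tape M :=
  Tape (match a.2 with
        | Left => (head t).-1
        | Stay => head t
        | Right => (head t).+1
        end)
       (set_nth None (cells t) (head t) a.1).

(* The longest block of bits starting at the first cell. *)
Fixpoint bit_prefix (M : oracleTM) (s : seq (symbol M)) : word :=
  if s is Some (inl b) :: s' then b :: bit_prefix s' else [::].

Record config (M : oracleTM) := Config {
  cstate : state M;
  ctapes : {ffun 'I_(nwork M).+2 -> tape M}
}.

Definition initial (M : oracleTM) (x : word) : config M :=
  Config (qstart M)
    [ffun i => Tape 0 (if i == ord0 then [seq Some (inl b) | b <- x]
                       else [::])].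

Definition scanned (M : oracleTM) (c : config M) :
    {ffun 'I_(nwork M).+2 -> symbol M} :=
  [ffun i => scan (ctapes c i)].

Definition query (M : oracleTM) (c : config M) : word :=
  bit_prefix (cells (ctapes c ord_max)).

(* qaccept is halting; any other configuration without successor rejects. *)
Inductive step (M : oracleTM) (A : set word) (c : config M) :
    config M -> Prop :=
| step_yes : cstate c != qaccept M -> cstate c = qquery M ->
    A (query c) -> step A c (Config (qyes M) (ctapes c))
| step_no : cstate c != qaccept M -> cstate c = qquery M ->
    ~ A (query c) -> step A c (Config (qno M) (ctapes c))
| step_delta a : cstate c != qaccept M -> cstate c != qquery M ->
    a \in delta (cstate c) (scanned c) ->
    step A c (Config a.1 [ffun i => act (ctapes c i) (a.2 i)]).

Fixpoint computation (M : oracleTM) (A : set word) (c : config M)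
    (s : seq (config M)) : Prop :=
  if s is c' :: s' then step A c c' /\ computation A c' s' else True.

Definition accepts (M : oracleTM) (A : set word) (x : word) : Prop :=
  exists2 s, computation A (initial M x) s &
             cstate (last (initial M x) s) = qaccept M.

Definition language (M : oracleTM) (A : set word) : set word :=
  [set x | accepts M A x].

(* Computations may be partial, so an infinite path excludes any runtime. *)
Definition runtime (M : oracleTM) (A : set word) (x : word) (t : nat) : Prop :=
  (exists2 s, computation A (initial M x) s & size s = t) /\
  (forall s, computation A (initial M x) s -> size s <= t).

Definition time_bounded (M : oracleTM) (D : set word) (p : {poly nat}) : Prop :=
  forall x : word, exists2 t, runtime M D x t & t <= p.[size x]%R.

Definition global_polynomial (M : oracleTM) : Prop :=
  exists p : {poly nat}, forall D : set word, time_bounded M D p.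

Definition local_polynomial (M : oracleTM) : Prop :=
  forall D : set word, exists p : {poly nat}, time_bounded M D p.

Definition almost_equal (X Y : set word) : Prop :=
  finite_set ((X `\` Y) `|` (Y `\` X)).

(* Main.v *)
(* One deterministic machine [Mhat] serves both versions.  On input x it looks
   for the least k <= |x| with 1^k in the oracle A (rejecting if there is none)
   and then asks A for its verdict on x at the word
     advice k x = 1^k 0 1^(pad |x| k) 0 rev(x),
   where n^k <= pad n k + 1 and, for fixed k, pad n k is polynomial in n.  So
   the runtime is polynomial with an exponent dictated by A, hence not uniformly
   in A.
   Given M running in time p, choose k with p(n) <= n^k for n >= N.  Then
   advice k x is too long to be queried by M on x, so an oracle containing 1^k
   can be built in stages by word length with
     advice k x in A  <->  M^A rejects x      (|x| >= N),
   which makes L(M^A) and L(Mhat^A) complementary up to words shorter than N. *)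
Require Import Defs.
From HB Require Import structures.
From mathcomp Require Import all_boot all_algebra.
From mathcomp Require Import boolp classical_sets cardinality.
From mathcomp Require Import zify.

Set Implicit Arguments.
Unset Strict Implicit.
Unset Printing Implicit Defensive.

Local Open Scope classical_set_scope.

(** * Deterministic computations *)

Section Computations.

Variables (M : oracleTM) (A : set word).

Definition halting (c : config M) := forall c', ~ step A c c'.

Definition run (m : nat) (c c' : config M) :=
  exists s : seq (config M), [/\ computation A c s, size s = m & last c s = c'].

Lemma run0 c : run 0 c c.
Proof. by exists [::]. Qed.

Lemma run_step c c' : step A c c' -> run 1 c c'.
Proof. by move=> cc'; exists [:: c']. Qed.

Lemma computation_cat (c : config M) s s' :
  computation A c (s ++ s') <->
  computation A c s /\ computation A (last c s) s'.
Proof.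
elim: s c => [|d s IHs] c /=; first by split=> [|[]].
split=> [[cd /(IHs d)[ds ss']]|[[cd ds] ss']]; first by do !split.
by split=> //; apply/IHs.
Qed.

Lemma run_trans m m' c c' c'' :
  run m c c' -> run m' c' c'' -> run (m + m') c c''.
Proof.
move=> [s [cs <- <-]] [s' [cs' <- <-]]; exists (s ++ s').
by split; rewrite ?size_cat ?last_cat //; apply/computation_cat.
Qed.

Lemma halting_accept c : cstate c = qaccept M -> halting c.
Proof. by move=> cq c' []; rewrite cq eqxx. Qed.

Hypothesis detM : deterministic M.

Lemma step_inj (c c1 c2 : config M) : step A c c1 -> step A c c2 -> c1 = c2.
Proof.
case=> [_ cq Aq|_ cq Aq|a _ cq aP] [_ cq' Aq'|_ cq' Aq'|b _ cq' bP] //;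
  try by [rewrite cq eqxx in cq' | rewrite cq' eqxx in cq].
by have /card_le1_eqP/(_ _ _ aP bP) -> := detM (cstate c) (scanned c).
Qed.

(** By determinism every computation from [c] is a prefix of the one that halts. *)
Lemma computation_maximal (c : config M) s s' :
  computation A c s -> halting (last c s) -> computation A c s' ->
  size s' <= size s /\ (halting (last c s') -> s' = s).
Proof.
elim: s c s' => [|d s IHs] c [|d' s'] //=.
- by move=> _ hc [/hc].
- by move=> [cd _] _ _; split=> // /(_ _ cd).
move=> [cd ds] hs [cd' ds']; have dd' := step_inj cd' cd; subst d'.
by have [? eq_s] := IHs d s' ds hs ds'; split=> // /eq_s ->.
Qed.

Lemma halting_run m x c :
    run m (initial M x) c -> halting c ->
  runtime M A x m /\ (accepts M A x <-> cstate c = qaccept M).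
Proof.
move=> [s [xs <- <-]] hs; split; first split; first by exists s.
  by move=> s' /(computation_maximal xs hs) [].
split=> [[s' xs' qs']|]; last by exists s.
by have [_ <-] := computation_maximal xs hs xs'; last exact: halting_accept.
Qed.

End Computations.

(** * The machine *)

Inductive mstate :=
  Start | Ask | Yes | No | Accept | Copy | Phase | ULeft | RLeft | RRight
  | URight | VLeft | VRight | Emit.

Definition ord_of_mstate (q : mstate) : 'I_14 :=
  inord match q with
  | Start => 0 | Ask => 1 | Yes => 2 | No => 3 | Accept => 4 | Copy => 5
  | Phase => 6 | ULeft => 7 | RLeft => 8 | RRight => 9 | URight => 10
  | VLeft => 11 | VRight => 12 | Emit => 13
  end.

Definition mstate_of_ord (i : 'I_14) : mstate :=
  nth Start [:: Start; Ask; Yes; No; Accept; Copy; Phase; ULeft; RLeft; RRight;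
                URight; VLeft; VRight; Emit] i.

Lemma ord_of_mstateK : cancel ord_of_mstate mstate_of_ord.
Proof. by case; rewrite /mstate_of_ord inordK. Qed.

HB.instance Definition _ := Finite.copy mstate (can_type ord_of_mstateK).

Definition sym : finType := option (bool + void)%type.

Definition bit (b : bool) : sym := Some (inl b).
Definition bits (w : word) : seq sym := map bit w.

Definition keep (s : sym) := (s, Stay).
Definition toleft (s : sym) := (s, Left).
Definition toright (s : sym) := (s, Right).

(* The tapes are the input [x], a ruler [r] holding a blank followed by x, a
   phase counter [c] and a work tape [u] holding a blank followed by k resp. a
   ones, and the oracle tape [v] holding 1^k 0 1^b.  The blank, resp. the zero,
   marks the left end.  A phase decrements [c], adds a * |x| ones to [v] (one
   ruler sweep per one on [u]), and then adds as many ones to [u] as [v] has.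
   After a query, [u] is scanned at a blank while searching for k and at a one
   after the final query. *)
Definition trans (q : mstate) (x r c u v : sym) :
    option (mstate * seq (sym * move)) :=
  match q, x, r, c, u, v with
  | Start, _, _, _, _, _ =>
      Some (Ask, [:: keep x; toright r; toright c; toright u; keep v])
  | No, Some _, _, _, _, _ =>
      Some (Ask, [:: toright x; toright x; toright (bit true); keep u;
                     toright (bit true)])
  | Yes, _, _, _, None, _ =>
      Some (Copy, [:: keep x; keep r; keep c; toright (bit true);
                      toright (bit false)])
  | Yes, _, _, _, Some _, _ =>
      Some (Accept, [:: keep x; keep r; keep c; keep u; keep v])
  | Copy, Some _, _, _, _, _ =>
      Some (Copy, [:: toright x; toright x; keep c; keep u; keep v])
  | Copy, None, _, _, _, _ =>
      Some (Phase, [:: keep x; keep r; toleft c; keep u; keep v])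
  | Phase, _, _, Some _, _, _ =>
      Some (ULeft, [:: keep x; keep r; toleft c; toleft u; keep v])
  | Phase, _, _, None, _, _ =>
      Some (Emit, [:: keep x; toleft r; keep c; toleft u; toright (bit false)])
  | ULeft, _, _, _, Some _, _ =>
      Some (RLeft, [:: keep x; toleft r; keep c; toleft u; keep v])
  | ULeft, _, _, _, None, _ =>
      Some (URight, [:: keep x; keep r; keep c; toright u; keep v])
  | RLeft, _, Some _, _, _, _ =>
      Some (RLeft, [:: keep x; toleft r; keep c; keep u; toright (bit true)])
  | RLeft, _, None, _, _, _ =>
      Some (RRight, [:: keep x; toright r; keep c; keep u; keep v])
  | RRight, _, Some _, _, _, _ =>
      Some (RRight, [:: keep x; toright r; keep c; keep u; keep v])
  | RRight, _, None, _, _, _ =>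
      Some (ULeft, [:: keep x; keep r; keep c; keep u; keep v])
  | URight, _, _, _, Some _, _ =>
      Some (URight, [:: keep x; keep r; keep c; toright u; keep v])
  | URight, _, _, _, None, _ =>
      Some (VLeft, [:: keep x; keep r; keep c; keep u; toleft v])
  | VLeft, _, _, _, _, Some (inl true) =>
      Some (VLeft, [:: keep x; keep r; keep c; toright (bit true); toleft v])
  | VLeft, _, _, _, _, _ =>
      Some (VRight, [:: keep x; keep r; keep c; keep u; toright v])
  | VRight, _, _, _, _, Some _ =>
      Some (VRight, [:: keep x; keep r; keep c; keep u; toright v])
  | VRight, _, _, _, _, None =>
      Some (Phase, [:: keep x; keep r; keep c; keep u; keep v])
  | Emit, _, Some _, _, _, _ =>
      Some (Emit, [:: keep x; toleft r; keep c; keep u; toright r])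
  | Emit, _, None, _, _, _ =>
      Some (Ask, [:: keep x; keep r; keep c; keep u; keep v])
  | No, None, _, _, _, _ | Ask, _, _, _, _, _ | Accept, _, _, _, _, _ => None
  end.

Definition Mhat : oracleTM :=
  @OracleTM mstate void 3 Start Accept Ask Yes No
    (fun q (s : {ffun 'I_5 -> sym}) =>
       if trans q (s (inord 0)) (s (inord 1)) (s (inord 2)) (s (inord 3))
            (s (inord 4)) is Some (q', acts)
       then [set (q', [ffun i : 'I_5 => nth (None, Stay) acts i])]
       else finset.set0)%SET.

Lemma deterministic_Mhat : deterministic Mhat.
Proof.
by move=> q s /=; case: trans => [[q' acts]|]; rewrite ?cards1 ?cards0.
Qed.

(* Head position and contents, the latter up to trailing blanks. *)
Definition atape := (nat * seq sym)%type.
Definition aconfig := (mstate * seq atape)%type.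

Definition read (t : atape) : sym := nth None t.2 t.1.
Definition atape0 : atape := (0, [::]).

Definition tape_is (t : tape Mhat) (u : atape) :=
  Defs.head t = u.1 /\ forall i, nth None (cells t) i = nth None u.2 i.

Definition models (c : config Mhat) (a : aconfig) :=
  cstate c = a.1 /\ forall i, tape_is (ctapes c i) (nth atape0 a.2 i).

(** A relation rather than a function, because contents count only up to trailing blanks: moving
    right past the end need not extend the list. *)
Definition updates (t : atape) (a : sym * move) (t' : atape) :=
  t'.1 = (match a.2 with Left => t.1.-1 | Stay => t.1 | Right => t.1.+1 end) /\
  forall i, nth None t'.2 i = if i == t.1 then a.1 else nth None t.2 i.

Lemma updates_keep h s a : nth None s h = a -> updates (h, s) (keep a) (h, s).
Proof. by move=> sa; split=> //= i; case: eqP => [->|]. Qed.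

Lemma updates_toleft h h' s a : nth None s h = a -> h' = h.-1 ->
  updates (h, s) (toleft a) (h', s).
Proof. by move=> sa; split=> //= i; case: eqP => [->|]. Qed.

Lemma updates_toright h h' s a : nth None s h = a -> h' = h.+1 ->
  updates (h, s) (toright a) (h', s).
Proof. by move=> sa; split=> //= i; case: eqP => [->|]. Qed.

Lemma updates_append h h' s b s' : h = size s -> h' = h.+1 -> s' = rcons s b ->
  updates (h, s) (toright b) (h', s').
Proof.
move=> -> -> ->; split=> //= i; rewrite nth_rcons.
by case: ltngtP => // lt; rewrite ?nth_default // ltnW.
Qed.

Lemma ord5P (P : 'I_5 -> Prop) :
  P (inord 0) -> P (inord 1) -> P (inord 2) -> P (inord 3) -> P (inord 4) ->
  forall i, P i.
Proof.
move=> P0 P1 P2 P3 P4 [i lti]; have [//|] := pselect (P (Ordinal lti)).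
by case: i lti => [|[|[|[|[|]]]]] // lti [];
  [move: P0|move: P1|move: P2|move: P3|move: P4];
  congr P; apply/val_inj; rewrite /= inordK.
Qed.

(* Effect of one phase on the numbers (a, b) of ones on the tapes u and v. *)
Definition grow (n : nat) (ab : nat * nat) :=
  let b := ab.2 + ab.1 * n in (ab.1 + b, b).

Definition lengths n i := iter i (grow n) (1, 0).

Definition pad n i := (lengths n i).2.

(** A phase adds at least [a * n] to both numbers, which raises the exponent by one. The second
    bound is what makes advice words longer than [n ^ k]. *)
Lemma lengths_lower n i : n ^ i <= (lengths n i).1 /\ n ^ i <= (pad n i).+1.
Proof.
rewrite /pad; elim: i => //= i; case: (lengths n i) => a b /= [IHa IHb].
by rewrite expnS; nia.
Qed.

(** A phase multiplies [a + b + 1] by at most [2 * n + 2]. For fixed [i] the bound is polynomial in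
    [n]. *)
Lemma lengths_upper n i :
  ((lengths n i).1 + (lengths n i).2).+1 <= 2 * (2 * n + 2) ^ i.
Proof.
elim: i => //= i; case: (lengths n i) => a b /= IHi.
by rewrite expnS; nia.
Qed.

Lemma lengths_gt0 n i : 0 < (lengths n i).1.
Proof. by elim: i => //= i; case: (lengths n i) => a b /=; lia. Qed.

Definition advice (k : nat) (x : word) : word :=
  nseq k true ++ false :: nseq (pad (size x) k) true ++ false :: rev x.

(** * Runs between abstract configurations, with step bounds *)

Section Simulation.

Variable A : set word.

(** At most [m] steps, so that bounds can be rounded up; for all [c], since [a] fixes the tapes only
    up to trailing blanks. *)
Definition goes (m : nat) (a a' : aconfig) :=
  forall c, models c a -> exists2 m', m' <= m &
    exists2 c', run A m' c c' & models c' a'.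

Lemma goes0 a : goes 0 a a.
Proof. by move=> c ca; exists 0 => //; exists c; first exact: run0. Qed.

Lemma goes_trans a' m m' a a'' :
  goes m a a' -> goes m' a' a'' -> goes (m + m') a a''.
Proof.
move=> aa' aa'' c /aa' [k km [c' cc' /aa'' [k' km' [c'' cc'' ?]]]].
by exists (k + k'); [exact: leq_add | exists c''; first exact: run_trans cc''].
Qed.

Lemma goes_leq m m' a a' : goes m a a' -> m <= m' -> goes m' a a'.
Proof.
by move=> aa' mm' c /aa' [k km ?]; exists k; first exact: leq_trans mm'.
Qed.

Lemma mem_delta q q' acts (s : {ffun 'I_(nwork Mhat).+2 -> symbol Mhat}) :
    trans q (s (inord 0)) (s (inord 1)) (s (inord 2)) (s (inord 3))
      (s (inord 4)) = Some (q', acts) ->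
  (q', [ffun i : 'I_5 => nth (None, Stay) acts i]) \in @delta Mhat q s.
Proof. by move=> tq; rewrite /delta /= tq inE. Qed.

Lemma delta_trans_None q (s : {ffun 'I_(nwork Mhat).+2 -> symbol Mhat}) :
    trans q (s (inord 0)) (s (inord 1)) (s (inord 2)) (s (inord 3))
      (s (inord 4)) = None ->
  @delta Mhat q s = finset.set0.
Proof. by move=> tq; rewrite /delta /= tq. Qed.

Lemma models_scanned c q ts i : models c (q, ts) -> i < 5 ->
  scanned c (inord i) = read (nth atape0 ts i).
Proof.
move=> [_ /(_ (inord i))] + lti; rewrite inordK // => -[eh ec].
by rewrite /scanned ffunE /scan eh ec.
Qed.

Lemma goes_trans1 q t0 t1 t2 t3 t4 q' a0 a1 a2 a3 a4 t0' t1' t2' t3' t4' :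
    trans q (read t0) (read t1) (read t2) (read t3) (read t4) =
      Some (q', [:: a0; a1; a2; a3; a4]) ->
    updates t0 a0 t0' -> updates t1 a1 t1' -> updates t2 a2 t2' ->
    updates t3 a3 t3' -> updates t4 a4 t4' ->
  goes 1 (q, [:: t0; t1; t2; t3; t4]) (q', [:: t0'; t1'; t2'; t3'; t4']).
Proof.
move=> tq u0 u1 u2 u3 u4 c mc; exists 1 => //.
set acts := [:: _; _; _; _; _] in tq.
pose a : mstate * {ffun 'I_5 -> sym * move} :=
  (q', [ffun i : 'I_5 => nth (None, Stay) acts i]).
have [cq ct] := mc.
exists (@Config Mhat a.1 [ffun i => act (ctapes c i) (a.2 i)]).
  apply: run_step; apply: step_delta; rewrite cq /=.
  (* [trans] is undefined at [Accept] and at [Ask], so [q] is neither. *)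
  - by apply/eqP => eq_q; rewrite eq_q in tq.
  - by apply/eqP => eq_q; rewrite eq_q in tq.
  by rewrite /a; apply: mem_delta; rewrite !(models_scanned mc).
split=> // i; rewrite ffunE /a ffunE.
have updates_act t b t' (tau : tape Mhat) :
    tape_is tau t -> updates t b t' -> tape_is (act tau b) t'.
  move=> [eh ec] [eh' ec']; split; first by rewrite eh' /= eh.
  by move=> j; rewrite /= nth_set_nth /= eh ec' ec.
by apply: updates_act (ct i) _; move: i; apply: ord5P; rewrite !inordK.
Qed.

(** Trailing blanks do not alter a query: the cell after [w] reads blank and ends the block of
    bits. *)
Lemma bit_prefix_bits w (s : seq (symbol Mhat)) :
  (forall i, nth None s i = nth None (bits w) i) -> bit_prefix s = w.
Proof.
elim: w s => [|b w IHw] [|a s] //= sw.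
- by move: (sw 0) => /= ->.
- by have := sw 0.
by have /= -> := sw 0; rewrite IHw // => i; apply: (sw i.+1).
Qed.

Lemma query_models c q t0 t1 t2 t3 h w :
  models c (q, [:: t0; t1; t2; t3; (h, bits w)]) -> query c = w.
Proof. by move=> [_ /(_ ord_max)[_ cw]]; apply: bit_prefix_bits. Qed.

Lemma Ask_neq_Accept : Ask != Accept.
Proof. by apply/eqP. Qed.

Lemma goes_ask t0 t1 t2 t3 h w q :
    (A w /\ q = Yes) \/ (~ A w /\ q = No) ->
  goes 1 (Ask, [:: t0; t1; t2; t3; (h, bits w)])
         (q, [:: t0; t1; t2; t3; (h, bits w)]).
Proof.
move=> Aw c mc; exists 1 => //; have [cq ct] := mc.
exists (@Config Mhat q (ctapes c)); last by split.
apply: run_step; case: Aw => -[Aw ->].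
  by apply: step_yes; rewrite ?cq ?Ask_neq_Accept ?(query_models mc).
by apply: step_no; rewrite ?cq ?Ask_neq_Accept ?(query_models mc).
Qed.

Lemma rcons_nseq T (a : T) m : rcons (nseq m a) a = nseq m.+1 a.
Proof. by elim: m => //= m ->. Qed.

(** * The stages of a run on a fixed input *)

Section Stages.

Variables (x : word) (k : nat).
Let n := size x.

(** The counter is decremented by moving its head, so its value is [hc]; its [k] ones stay in
    place. *)
Definition stage q hr hc a hu b hv : aconfig :=
  (q, [:: (n, bits x); (hr, None :: bits x); (hc, None :: nseq k (bit true));
          (hu, None :: nseq a (bit true));
          (hv, nseq k (bit true) ++ bit false :: nseq b (bit true))]).

Lemma nth_bits_lt i : i < n -> nth None (bits x) i = bit (nth false x i).
Proof. exact: nth_map. Qed.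

Lemma nth_bits_size : nth None (bits x) n = None.
Proof. by rewrite nth_default ?size_map. Qed.

Ltac update h := first
  [ apply: updates_keep; solve [rewrite /= ?h //]
  | apply: updates_toleft; [solve [rewrite /= ?h //] | solve [rewrite /=; lia]]
  | apply: updates_toright; [solve [rewrite /= ?h //] | solve [rewrite /=; lia]]
  | apply: updates_append;
    [ solve [rewrite /= ?size_cat /= ?size_nseq ?size_map; lia]
    | solve [rewrite /=; lia]
    | solve [rewrite /= ?rcons_cat /= ?rcons_nseq ?h //] ] ].

(* [h]: equation for the scanned symbol on which the transition branches. *)
Ltac machine_step h :=
  eapply goes_trans1; [rewrite /read /= ?h; reflexivity | update h ..].

Lemma goes_rleft j hc a hu b : j <= n ->
  goes j.+1 (stage RLeft j hc a hu b (k.+1 + b))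
            (stage RRight 1 hc a hu (b + j) (k.+1 + (b + j))).
Proof.
elim: j b => [|j IHj] b jn.
  rewrite addn0; machine_step (erefl 0).
rewrite -addSnnS.
apply: (@goes_trans (stage RLeft j hc a hu b.+1 (k.+1 + b.+1)) 1).
  machine_step (nth_bits_lt jn).
exact/IHj/ltnW.
Qed.

Lemma goes_rright i j hc a hu b hv : i + j = n ->
  goes i.+1 (stage RRight j.+1 hc a hu b hv) (stage ULeft n.+1 hc a hu b hv).
Proof.
elim: i j => [|i IHi] j ijn.
  by move: ijn; rewrite add0n => ->; machine_step nth_bits_size.
have jn : j < n by lia.
apply: (@goes_trans (stage RRight j.+2 hc a hu b hv) 1).
  machine_step (nth_bits_lt jn).
by apply: IHi; lia.
Qed.

Lemma nth_ones_lt i a : i < a -> nth None (nseq a (bit true)) i = bit true.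
Proof. by rewrite nth_nseq => ->. Qed.

Lemma nth_ones_size a : nth None (nseq a (bit true)) a = None.
Proof. by rewrite nth_nseq ltnn. Qed.

(** Each one on [u] costs 1 + (n + 1) + (n + 1) steps: leaving it, sweeping the ruler left while
    appending [n] ones to [v], and sweeping back. *)
Lemma goes_uleft i hc a b : i <= a ->
  goes (i * (2 * n + 3)).+1
    (stage ULeft n.+1 hc a i b (k.+1 + b))
    (stage URight n.+1 hc a 1 (b + i * n) (k.+1 + (b + i * n))).
Proof.
elim: i b => [|i IHi] b ia; first by rewrite addn0; machine_step (erefl 0).
apply: (goes_leq (m := 1 + (n.+1 + (n.+1 + (i * (2 * n + 3)).+1))));
  last by lia.
apply: (@goes_trans (stage RLeft n hc a i b (k.+1 + b))).
  machine_step (nth_ones_lt ia).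
apply: goes_trans (goes_rleft (leqnn n)) _.
apply: goes_trans (goes_rright (addn0 n)) _.
have -> : b + i.+1 * n = b + n + i * n by rewrite mulSn addnA.
by apply: IHi; apply: ltnW.
Qed.

Lemma goes_uright i j hr hc a b hv : i + j = a ->
  goes i.+1 (stage URight hr hc a j.+1 b hv) (stage VLeft hr hc a a.+1 b hv.-1).
Proof.
elim: i j => [|i IHi] j ija.
  by move: ija; rewrite add0n => ->; machine_step nth_ones_size.
have ja : j < a by lia.
apply: (@goes_trans (stage URight hr hc a j.+2 b hv) 1).
  machine_step (nth_ones_lt ja).
by apply: IHi; lia.
Qed.

Lemma nth_pad b j :
  nth None (nseq k (bit true) ++ bit false :: nseq b (bit true)) (k + j) =
  nth None (bit false :: nseq b (bit true)) j.
Proof. by rewrite nth_cat size_nseq ltnNge leq_addr addKn. Qed.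

(** Every one passed on [v] is appended to [u]; the zero at cell [k] stops the sweep before the
    block 1^k. *)
Lemma goes_vleft j hr hc a b : j <= b ->
  goes j.+1 (stage VLeft hr hc a a.+1 b (k + j))
            (stage VRight hr hc (a + j) (a + j).+1 b k.+1).
Proof.
elim: j a => [|j IHj] a jb.
  by rewrite [a + 0]addn0; machine_step (nth_pad b 0).
rewrite -[a + _]addSnnS.
apply: (@goes_trans (stage VLeft hr hc a.+1 a.+2 b (k + j)) 1).
  have h : nth None (nseq k (bit true) ++ bit false :: nseq b (bit true))
      (k + j.+1) = bit true.
    by rewrite nth_pad /= nth_ones_lt.
  machine_step h.
by apply: IHj; apply: ltnW.
Qed.

Lemma goes_vright i j hr hc a hu b : i + j = b ->
  goes i.+1 (stage VRight hr hc a hu b (k.+1 + j))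
            (stage Phase hr hc a hu b (k.+1 + b)).
Proof.
elim: i j => [|i IHi] j ijb.
  have h : nth None (nseq k (bit true) ++ bit false :: nseq b (bit true))
      (k.+1 + b) = None.
    by rewrite addSnnS nth_pad /= nth_ones_size.
  by move: ijb; rewrite add0n => ->; machine_step h.
have jb : j < b by lia.
apply: (@goes_trans (stage VRight hr hc a hu b (k.+1 + j.+1)) 1).
  have h : nth None (nseq k (bit true) ++ bit false :: nseq b (bit true))
      (k.+1 + j) = bit true.
    by rewrite addSnnS nth_pad /= nth_ones_lt.
  machine_step h.
by apply: IHi; lia.
Qed.

Lemma goes_phase i a b : i < k ->
  goes ((4 * n + 9) * (a + b).+1)
    (stage Phase n.+1 i.+1 a a.+1 b (k.+1 + b))
    (stage Phase n.+1 i (a + (b + a * n)) (a + (b + a * n)).+1 (b + a * n)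
      (k.+1 + (b + a * n))).
Proof.
move=> ik; set b' := b + a * n.
(* The summands are the decrement, the ruler sweeps, the walk to the end of [u], the copying pass
   over [v] and the return on [v]. *)
apply: (goes_leq (m := 1 + ((a * (2 * n + 3)).+1 + (a.+1 + (b'.+1 + b'.+1)))));
  last by rewrite /b'; nia.
apply: (@goes_trans (stage ULeft n.+1 i a a b (k.+1 + b))).
  machine_step (nth_ones_lt ik).
apply: goes_trans (goes_uleft (leqnn a)) _.
apply: goes_trans (goes_uright (addn0 a)) _.
rewrite addSn /= -/b'.
apply: goes_trans (goes_vleft (leqnn b')) _.
have := @goes_vright b' 0 n.+1 i (a + b') (a + b').+1 b' (addn0 b').
by rewrite (addn0 k.+1).
Qed.

Let len m := (lengths n m).1.

(** Here [m] phases are done and [i] remain; each is charged the worst case that [lengths_upper]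
    allows at exponent [k]. *)
Lemma goes_phases i m : m + i = k ->
  goes (i * ((4 * n + 9) * (2 * (2 * n + 2) ^ k)))
    (stage Phase n.+1 i (len m) (len m).+1 (pad n m) (k.+1 + pad n m))
    (stage Phase n.+1 0 (len k) (len k).+1 (pad n k) (k.+1 + pad n k)).
Proof.
elim: i m => [|i IHi] m mik; first by rewrite -mik addn0; exact: goes0.
rewrite mulSn; apply: goes_trans _ (IHi m.+1 _); last by lia.
have ik : i < k by lia.
apply: (goes_leq (goes_phase (a := len m) (b := pad n m) ik)).
rewrite leq_mul2l (leq_trans (lengths_upper n m)) ?orbT // leq_mul2l /=.
by rewrite leq_exp2l; lia.
Qed.

Definition emit q j a w : aconfig :=
  (q, [:: (n, bits x); (j, None :: bits x); (0, None :: nseq k (bit true));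
          (a, None :: nseq a (bit true)); (size w, bits w)]).

(** The ruler is read from right to left, which is why advice words end in the reversal of [x]. *)
Lemma goes_emit j a w : j <= n ->
  goes j.+1 (emit Emit j a w) (emit Ask 0 a (w ++ rev (take j x))).
Proof.
elim: j w => [|j IHj] w jn.
  by rewrite take0 cats0; machine_step (erefl 0).
rewrite (take_nth false) // rev_rcons -cat_rcons.
apply: (@goes_trans (emit Emit j a (rcons w (nth false x j))) 1).
  have e := nth_bits_lt jn.
  eapply goes_trans1; [rewrite /read /= ?e; reflexivity | update e .. | ].
  by apply: updates_append; rewrite ?size_map ?size_rcons // /bits map_rcons.
by apply: IHj; apply: ltnW.
Qed.

Lemma goes_query :
  goes n.+2
    (stage Phase n.+1 0 (len k) (len k).+1 (pad n k) (k.+1 + pad n k))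
    (emit Ask 0 (len k) (advice k x)).
Proof.
set w := nseq k true ++ false :: rcons (nseq (pad n k) true) false.
apply: (@goes_trans (emit Emit n (len k) w) 1).
  eapply goes_trans1; [reflexivity | update (erefl 0) .. | ].
  apply: updates_append; rewrite /w ?size_cat /= ?size_rcons ?size_nseq;
    try lia.
  by rewrite /bits map_cat /= map_rcons !map_nseq rcons_cat.
have -> : advice k x = w ++ rev (take n x).
  by rewrite /advice /w take_size -catA /= cat_rcons.
exact: goes_emit.
Qed.

(** The search doubles as preparation: on success at [j = k] the counter already holds [k], and only
    the letters of [x] from position [k] on remain to be copied to the ruler. *)
Definition search q j : aconfig :=
  (q, [:: (j, bits x); (j.+1, None :: bits (take j x));
          (j.+1, None :: nseq j (bit true)); (1, [:: None]);
          (j, bits (nseq j true))]).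

Definition start : aconfig :=
  (Start, [:: (0, bits x); (0, [::]); (0, [::]); (0, [::]); (0, [::])]).

Lemma goes_start : goes 1 start (search Ask 0).
Proof.
rewrite /search take0; eapply goes_trans1; [reflexivity | ..].
- exact: updates_keep.
- by apply: updates_append => //; rewrite /read.
- by apply: updates_append => //; rewrite /read.
- by apply: updates_append => //; rewrite /read.
- exact: updates_keep.
Qed.

Lemma goes_search j : j <= n -> (forall i, i < j -> ~ A (nseq i true)) ->
  goes (2 * j) (search Ask 0) (search Ask j).
Proof.
elim: j => [|j IHj] jn Aj; first exact: goes0.
apply: (goes_leq (m := 2 * j + (1 + 1))); last by lia.
apply: goes_trans (IHj (ltnW jn) _) _; first by move=> i ij; apply/Aj/ltnW.
apply: goes_trans (goes_ask (or_intror (conj (Aj j _) erefl))) _ => //.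
have e := nth_bits_lt jn; rewrite -/(search No j).
eapply goes_trans1;
  [by rewrite /read /= e | update e | | update e | update e |].
- apply: updates_append; rewrite /= ?size_map ?size_takel // 1?ltnW //.
  by rewrite (take_nth false) // /bits map_rcons.
by apply: updates_append; rewrite /bits ?map_nseq ?size_nseq ?rcons_nseq.
Qed.

Definition copy q j : aconfig :=
  (q, [:: (j, bits x); (j.+1, None :: bits (take j x));
          (k.+1, None :: nseq k (bit true)); (2, [:: None; bit true]);
          (k.+1, nseq k (bit true) ++ [:: bit false])]).

Lemma goes_copy i j : i + j = n ->
  goes i.+1 (copy Copy j) (stage Phase n.+1 k 1 2 0 (k.+1 + 0)).
Proof.
elim: i j => [|i IHi] j ijn.
  rewrite (_ : j = n) // /copy take_size addn0.
  machine_step nth_bits_size.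
have jn : j < n by lia.
have e := nth_bits_lt jn.
apply: (@goes_trans (copy Copy j.+1) 1); last by apply: IHi; lia.
eapply goes_trans1; [by rewrite /read /= e | update e | | update e ..].
apply: updates_append; rewrite /= ?size_map ?size_takel // 1?ltnW //.
by rewrite (take_nth false) // /bits map_rcons.
Qed.

(** The last summand pays for the [k] phases; the linear part covers search, copying and final
    query, given [k <= n]. *)
Definition time_bound := 3 * n + 10 + k * ((4 * n + 9) * (2 * (2 * n + 2) ^ k)).

Lemma goes_found q : k <= n -> (forall i, i < k -> ~ A (nseq i true)) ->
    A (nseq k true) ->
    (A (advice k x) /\ q = Accept) \/ (~ A (advice k x) /\ q = No) ->
  goes time_bound start (emit q 0 (len k) (advice k x)).
Proof.
move=> kn Ak_min Ak Aq.
pose phases := k * ((4 * n + 9) * (2 * (2 * n + 2) ^ k)).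
apply: (goes_leq (m := 1 + (2 * k + (1 + (1 + ((n - k).+1 + (phases +
  (n.+2 + (1 + 1)))))))));
  last by rewrite /time_bound -/phases; lia.
apply: goes_trans goes_start _.
apply: goes_trans (goes_search kn Ak_min) _.
apply: goes_trans (goes_ask (or_introl (conj Ak erefl))) _.
apply: (@goes_trans (copy Copy k)).
  eapply goes_trans1; [reflexivity | update (erefl 0) .. | | ].
    exact: updates_append.
  by apply: updates_append; rewrite /bits ?map_nseq ?size_nseq ?cats1.
apply: goes_trans (goes_copy (subnK kn)) _.
apply: goes_trans (goes_phases (add0n k)) _.
apply: goes_trans goes_query _.
case: Aq => -[Aq ->].
  apply: goes_trans (goes_ask (or_introl (conj Aq erefl))) _.
  (* Since [len k] is positive, the head on [u] scans a one, so [Yes] now leads to [Accept] and not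
     to [Copy]. *)
  have e : nth None (None :: nseq (len k) (bit true)) (len k) = bit true.
    move: (lengths_gt0 n k); rewrite /len.
    by case: (_.1) => // a _; exact: nth_ones_lt.
  rewrite /emit; machine_step e.
exact: goes_leq (goes_ask (or_intror (conj Aq erefl))) _.
Qed.

Lemma goes_not_found : (forall i, i <= n -> ~ A (nseq i true)) ->
  goes (2 * n + 2) start (search No n).
Proof.
move=> notA; apply: (goes_leq (m := 1 + (2 * n + 1))); last by lia.
apply: goes_trans goes_start _.
apply: goes_trans (goes_search (leqnn n) _) _; first by move=> i /ltnW/notA.
exact: goes_ask (or_intror (conj (notA n (leqnn n)) erefl)).
Qed.

Lemma models_initial : models (initial Mhat x) start.
Proof.
split=> //; apply: ord5P; rewrite inordK // ffunE; split=> //= i.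
all: rewrite -val_eqE /= ?inordK //.
Qed.

(** [No] resumes the search while the input head reads a letter and halts on the blank, hence the
    side condition. *)
Lemma goes_language q ts m : goes m start (q, ts) ->
    q = Accept \/ q = No /\ read (nth atape0 ts 0) = None ->
  (exists2 t, runtime Mhat A x t & t <= m) /\
  (language Mhat A x <-> q = Accept).
Proof.
move=> /(_ _ models_initial)[m' m'm [c xc cq]] q_final.
have [cs _] := cq; simpl in cs.
have /(halting_run deterministic_Mhat xc)[? ?] : halting A c; last first.
  by split; [exists m' | rewrite -cs].
case: q_final => [qA|[qN ts0]]; first by apply: halting_accept; rewrite cs qA.
move=> c' []; rewrite cs qN //.
move=> a _ _; rewrite delta_trans_None ?inE //.
by rewrite (models_scanned cq) // ts0.
Qed.

End Stages.

(** * Language and running time of the machine *)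

Lemma language_found k x : A (nseq k true) ->
    (forall i, i < k -> ~ A (nseq i true)) -> k <= size x ->
  (exists2 t, runtime Mhat A x t & t <= time_bound x k) /\
  (language Mhat A x <-> A (advice k x)).
Proof.
move=> Ak Ak_min kx; have [Aw|Aw] := pselect (A (advice k x)).
  have := goes_found kx Ak_min Ak (or_introl (conj Aw erefl)).
  case/goes_language => [|? ->].
    by left.
  by [].
have := goes_found kx Ak_min Ak (or_intror (conj Aw erefl)).
case/goes_language => [|? ->].
  by right; rewrite /read /= nth_bits_size.
by [].
Qed.

(** Serves the time bound on words shorter than the least [k], and on all words when the oracle
    contains no 1^k. *)
Lemma language_not_found x : (forall i, i <= size x -> ~ A (nseq i true)) ->
  exists2 t, runtime Mhat A x t & t <= 2 * size x + 2.
Proof.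
move=> /goes_not_found/goes_language[]//; right.
by rewrite /read /= nth_bits_size.
Qed.

End Simulation.

Lemma time_bound_poly k :
  exists p : {poly nat}, forall x, time_bound x k = p.[size x]%R.
Proof.
pose lin a b : {poly nat} := (a%:P * 'X + b%:P)%R.
have linE a b m : (lin a b).[m]%R = a * m + b by rewrite !hornerE.
exists (lin 3 10 + k%:P * (lin 4 9 * (2%:P * lin 2 2 ^+ k)))%R => x.
by rewrite hornerD !hornerM horner_exp !hornerC !linE natrXE.
Qed.

Lemma local_polynomial_Mhat : local_polynomial Mhat.
Proof.
move=> A; have [[k Ak]|noA] := pselect (exists k, A (nseq k true)).
  pose P k := `[< A (nseq k true) >].
  have exP : exists k, P k by exists k; apply/asboolP.
  have [m /asboolP Am m_min] := ex_minnP exP.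
  have [p pE] := time_bound_poly m; exists p => x; rewrite -pE.
  have notA i : i < m -> ~ A (nseq i true).
    by move=> im /asboolP/m_min; rewrite leqNgt im.
  have [mx|xm] := leqP m (size x).
    by have [] := language_found Am notA mx.
  have [|t xt tx] := @language_not_found A x.
    by move=> i ix; apply: notA; apply: leq_ltn_trans xm.
  by exists t => //; rewrite /time_bound; lia.
(* Without any 1^k in the oracle the run is linear, and [time_bound x 0] is large enough. *)
have [p pE] := time_bound_poly 0; exists p => x; rewrite -pE.
have [|t xt tx] := @language_not_found A x.
  by move=> i _ Ai; apply: noA; exists i.
by exists t => //; rewrite /time_bound; lia.
Qed.

(** * Computations under oracles agreeing on short words *)

Section Agreement.

Variables (M : oracleTM) (A B : set word) (t : nat).
Hypothesis agree : forall z, size z <= t -> A z <-> B z.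

(** Invariant after [i] steps: the oracle tape starts empty and gains at most one cell per step, so
    a query then has length at most [i]. *)
Definition oracle_bounded (i : nat) (c : config M) :=
  Defs.head (ctapes c ord_max) <= i /\ size (cells (ctapes c ord_max)) <= i.

Lemma size_bit_prefix (s : seq (symbol M)) : size (bit_prefix s) <= size s.
Proof. by elim: s => [|[[b|g]|] s IHs]. Qed.

Lemma step_agree i c c' : oracle_bounded i c -> i <= t ->
  step A c c' -> step B c c' /\ oracle_bounded i.+1 c'.
Proof.
move=> [hi si] it.
have qt : size (query c) <= t.
  exact: leq_trans (size_bit_prefix _) (leq_trans si it).
case=> [cA cQ Ac|cA cQ Ac|a cA cQ ac].
- by split; [apply/step_yes => //; apply/agree | split; apply: leqW].
- by split; [apply/step_no => // /(agree qt) | split; apply: leqW].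
split; first exact: step_delta.
split=> /=; rewrite ffunE /=;
  last by rewrite size_set_nth geq_max !ltnS hi leqW.
by case: (_.2) => //; rewrite ?ltnS ?leqW // (leq_trans (leq_pred _)) ?leqW.
Qed.

Lemma computation_agree i c s : oracle_bounded i c -> i + size s <= t ->
  computation A c s -> computation B c s.
Proof.
elim: s i c => //= c' s IHs i c ci it [cc' c's].
have [|cc'B c'i] := step_agree ci _ cc'; first by lia.
by split=> //; apply: IHs c'i _ c's; rewrite addSnnS.
Qed.

Lemma oracle_bounded_initial x : oracle_bounded 0 (initial M x).
Proof. by split; rewrite ffunE. Qed.

(** The accepting path under [A] has at most [t] steps, so it queries only words on which the
    oracles agree and is a path under [B] too. *)
Lemma accepts_agree x :
  (forall s, computation A (initial M x) s -> size s <= t) ->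
  accepts M A x -> accepts M B x.
Proof.
move=> xt [s xs qs]; exists s => //.
exact: computation_agree (oracle_bounded_initial x) (xt s xs) xs.
Qed.

End Agreement.

Lemma accepts_time_bounded (M : oracleTM) A B (p : {poly nat}) x :
    time_bounded M A p -> time_bounded M B p ->
    (forall z, size z <= p.[size x]%R -> A z <-> B z) ->
  accepts M A x <-> accepts M B x.
Proof.
move=> MA MB agree; split; apply: accepts_agree.
- exact: agree.
- by move=> s; have [t [_ xt] tp] := MA x; move=> /xt /leq_trans; apply.
- by move=> z /agree zAB; apply: iff_sym.
- by move=> s; have [t [_ xt] tp] := MB x; move=> /xt /leq_trans; apply.
Qed.

(** Induction along the Horner scheme: [1 < n] gives [c < n ^ c], so adding [c] to a positive number
    costs no more than multiplying it by [n ^ c]. *)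
Lemma horner_leq_expn (p : {poly nat}) :
  exists k, forall n, 1 < n -> p.[n]%R <= n ^ k.
Proof.
elim/poly_ind: p => [|p c [k IHk]]; first by exists 0 => n _; rewrite horner0.
exists (k.+1 + c) => n n1; rewrite hornerMXaddC.
have pn : (p.[n]%R * n <= n ^ k.+1)%N by rewrite expnSr leq_mul2r IHk ?orbT.
have cn : c < n ^ c by apply: ltn_expl.
have kn : 0 < n ^ k.+1 by rewrite expn_gt0; lia.
rewrite expnD.
change (p.[n]%R * n + c <= n ^ k.+1 * n ^ c); nia.
Qed.

Lemma finite_words n : finite_set [set x : word | size x < n].
Proof.
pose ws :=
  flatten [seq [seq tval t | t <- enum {:i.-tuple bool}] | i <- iota 0 n].
apply: (@sub_finite_set _ _ [set` ws]) => // x /= xn.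
apply/flatten_mapP; exists (size x); first by rewrite mem_iota.
by apply/mapP; exists (in_tuple x); rewrite ?mem_enum.
Qed.

(** After the common prefix 1^k 0, the position of the next zero reveals the length of the padding,
    so the remaining suffixes coincide. *)
Lemma advice_inj k : injective (advice k).
Proof.
have index_ones m w : index false (nseq m true ++ false :: w) = m.
  by elim: m => //= m ->.
move=> x y /eqP; rewrite eqseq_cat // eqxx eqseq_cons /= => /eqP e.
have pads := congr1 (index false) e; rewrite !index_ones in pads.
move: e; rewrite pads => /eqP.
rewrite eqseq_cat // eqxx /= eqseq_cons /= => /eqP.
exact: (can_inj revK).
Qed.

Lemma nseq_neq_advice j k x : nseq j true <> advice k x.
Proof.
move=> e; have : false \in advice k x by rewrite mem_cat inE eqxx orbT.
by rewrite -e mem_nseq andbF.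
Qed.

Lemma size_advice k x : size x ^ k < size (advice k x).
Proof.
rewrite /advice size_cat /= size_cat /= !size_nseq.
by have [_] := lengths_lower (size x) k; lia.
Qed.

(** * The oracle defeating a global-polynomial machine *)

Section Diagonal.

Variables (M : oracleTM) (k N : nat).

(** The membership rule for [z], where [S] is the oracle as settled on words shorter than [z]. *)
Definition decreed (S : set word) (z : word) :=
  z = nseq k true \/
  exists x, [/\ N <= size x, z = advice k x & ~ accepts M S x].

(* Acceptance of [x] depends only on words shorter than [advice k x], so the
   oracle can be built in stages by length. *)
Fixpoint stage_oracle (m : nat) : set word :=
  if m is m'.+1 then
    [set z | if size z == m' then decreed (stage_oracle m') z
             else stage_oracle m' z]
  else set0.

Definition diagonal : set word := [set z | stage_oracle (size z).+1 z].

(** Passing from stage [m] to the next changes only words of length [m], so shorter words are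
    already settled. *)
Lemma stage_oracleE m z : size z < m -> stage_oracle m z <-> diagonal z.
Proof.
elim: m => // m IHm; rewrite ltnS leq_eqVlt => /orP[/eqP <-|zm] //.
by rewrite -(IHm zm) /= ltn_eqF.
Qed.

Lemma diagonalE z : diagonal z <-> decreed (stage_oracle (size z)) z.
Proof. by rewrite /diagonal /= eqxx. Qed.

Variable p : {poly nat}.
Hypothesis M_p : forall D, time_bounded M D p.
Hypothesis p_small : forall n, N <= n -> p.[n]%R <= n ^ k.

Lemma diagonal_code i : diagonal (nseq i true) <-> i = k.
Proof.
rewrite diagonalE; split=> [[/(congr1 size)|[x [_ /nseq_neq_advice]]]|->] //.
  by rewrite !size_nseq.
by left.
Qed.

(** On [x] the machine queries words of length at most [p.[size x] <= size x ^ k], hence shorter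
    than [advice k x]; there the stage and the final oracle agree. Injectivity of [advice k] ensures
    that only [x] decides this word. *)
Lemma diagonal_advice x : N <= size x ->
  diagonal (advice k x) <-> ~ accepts M diagonal x.
Proof.
move=> Nx; set m := size (advice k x).
have eq_acc : accepts M (stage_oracle m) x <-> accepts M diagonal x.
  apply: accepts_time_bounded (M_p _) (M_p _) _ => z zp; apply: stage_oracleE.
  apply: leq_ltn_trans zp _; apply: leq_ltn_trans (p_small Nx) _.
  exact: size_advice.
rewrite diagonalE -/m.
split=> [[/esym/nseq_neq_advice //|[y [_ /advice_inj <-]]]|].
  by rewrite eq_acc.
by move=> nacc; right; exists x; split=> //; rewrite eq_acc.
Qed.

End Diagonal.

Lemma almost_complement_Mhat (M : oracleTM) : global_polynomial M ->
  exists A, almost_equal (language M A) (~` language Mhat A).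
Proof.
move=> [p M_p]; have [k pk] := horner_leq_expn p.
(* [N] is at least 2 for the power bound on [p], and at least [k] so that the search on words of
   length [N] or more reaches 1^k. *)
pose N := maxn 2 k; exists (diagonal M k N).
have p_small n : N <= n -> p.[n]%R <= n ^ k by rewrite geq_max => /andP[/pk].
have lang x : N <= size x ->
    (language Mhat (diagonal M k N) x <-> ~ language M (diagonal M k N) x).
  move=> Nx; rewrite -(diagonal_advice M_p p_small Nx).
  have [|||_ //] := @language_found (diagonal M k N) k x.
  - by apply/diagonal_code.
  - by move=> i ik /diagonal_code; lia.
  - by move: Nx; rewrite geq_max => /andP[].
apply: sub_finite_set (finite_words N) => x /=; rewrite ltnNge.
move=> diff; apply/negP => /lang xE.
by case: diff => -[] /=; rewrite xE; tauto.
Qed.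

Theorem theorem6p1 :
  (exists fN : set word -> set word,
      (exists2 Mhat : oracleTM, local_polynomial Mhat &
         forall A : set word, language Mhat A = fN A) /\
      (forall M : oracleTM, global_polynomial M ->
         exists A : set word, almost_equal (language M A) (~` fN A))) /\
  (exists fD : set word -> set word,
      (exists Mhat : oracleTM,
         [/\ deterministic Mhat, local_polynomial Mhat &
           forall A : set word, language Mhat A = fD A]) /\
      (forall M : oracleTM, deterministic M -> global_polynomial M ->
         exists A : set word, almost_equal (language M A) (~` fD A))).
Proof.
split; exists (language Mhat); split.
- by exists Mhat => //; exact: local_polynomial_Mhat.
- exact: almost_complement_Mhat.
- exists Mhat; split=> //; first exact: deterministic_Mhat.
  exact: local_polynomial_Mhat.
- by move=> M _; exact: almost_complement_Mhat.
Qed.
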